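(* Let $R$ be a commutative ring such that the exponent of the additive group $\operatorname{Nil}(R)^+$ is finite, and let $N$ be the least common multiple of the additive orders of the nilpotent elements of $R$. Then the power map $f(x) = x^n$ over $R$ is periodic for every positive integer $n$ that is not coprime with $N$. Accordingly, if $\mu_1 = \mu_1(R)$ and $\mu_0 = \mu_0(R)$ are finite, then $$\mu_P(R) \geq -\sum_{\substack{d \mid N \\ d \neq 1}} \mu(d)\left\lfloor\frac{\mu_0 + \mu_1 - 1}{d}\right\rfloor = \sum_{\substack{d \mid \operatorname{rad}(N) \\ d \neq 1}} (-1)^{\omega(d)+1}\left\lfloor\frac{\mu_0 + \mu_1 - 1}{d}\right\rfloor.$$ If $R$ is moreover finite and unital, then this lower bound is attained, i.e. $\mu_P(R)$ equals these sums.
   Context: Rings are associative and not necessarily unital. $\operatorname{Nil}(R)$ is the set of nilpotent elements of $R$; the order of an element always means its order in the additive group $R^+$. A power map over $R$ is a function $R \to R$, $f(x) = x^n$, for a fixed positive integer $n$. A function $f$ on $R^+$ is periodic if there is a nonzero $h \in R$ with $f(x+h) = f(x)$ for all $x \in R$. $\mu_P(R)$ is the number of distinct (as functions) power maps over $R$ that are periodic. The exponential period $\mu_1(R)$ is the smallest positive integer $n$ such that for each $x \in R$ there is a positive integer $m(x)$ with $x^{m(x)+n} = x^{m(x)}$. The onset of exponential periodicity is $\mu_0(R) = \max_{x \in R} \min\{m \in \mathbb{N} : x^{m+\mu_1} = x^m\}$ (with $\mathbb{N}$ the positive integers), provided the maximum exists. If these do not exist, $\mu_1$ and $\mu_0$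 are said to be infinite. For a positive integer $d$: $\mu(d)$ is the Möbius function, $\omega(d)$ is the number of distinct prime factors of $d$, and $\operatorname{rad}(d)$ is the product of the distinct prime factors of $d$. Sums run over positive divisors $d$. *)

(* Defs.v *)
From HB Require Import structures.
From mathcomp Require Import all_boot all_order all_algebra finmap.
From mathcomp Require Import all_classical.

Set Implicit Arguments.
Unset Strict Implicit.
Unset Printing Implicit Defensive.

Import Order.TTheory GRing.Theory Num.Theory.

(* Associative, not necessarily unital rings. The ring structures of ssralg are
   all unital, so the multiplication is that of a [semigroupType], written
   [x * y] in [group_scope], on top of the additive group of a [zmodType]. *)
HB.mixin Record isRng R of Semigroup R & GRing.Zmodule R := {
  rngDl : left_distributive *%g (+%R : R -> R -> R);
  rngDr : right_distributive *%g (+%R : R -> R -> R)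
}.

#[short(type="rngType")]
HB.structure Definition Rng :=
  { R of isRng R & Semigroup R & GRing.Zmodule R }.

Local Open Scope classical_set_scope.
Local Open Scope nat_scope.

(* The smallest positive integer satisfying [P]; by convention 0 when there is
   none, so that [0 < least P] means that the minimum exists. *)
Definition least (P : nat -> Prop) : nat :=
  xget 0 [set n | [/\ 0 < n, P n & forall m, 0 < m -> P m -> n <= m]].

(* The maximum of [F]; by convention 0 when it does not exist. *)
Definition greatest_value (T : Type) (F : T -> nat) : nat :=
  xget 0 [set m | (exists x, F x = m) /\ (forall x, F x <= m)].

Section RngDefs.
Variable R : rngType.

(* [x ^ n] for positive [n]; the value at [n = 0] is irrelevant. *)
Definition rpow (x : R) (n : nat) : R := iter n.-1 ( *%g x) x.

Definition power_map (n : nat) : R -> R := fun x => rpow x n.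

Definition periodic (f : R -> R) : Prop :=
  exists2 h : R, h <> 0%R & forall x : R, f (x + h)%R = f x.

Definition nilpotent_elt (x : R) : Prop := exists2 n, 0 < n & rpow x n = 0%R.

Definition unital : Prop :=
  exists e : R, forall x : R, (e * x)%g = x /\ (x * e)%g = x.

(* 0 for elements of infinite order *)
Definition add_order (x : R) : nat := least (fun k => (x *+ k)%R = 0%R).

End RngDefs.

Arguments power_map : clear implicits.

(* The exponent of Nil(R)^+, 0 when it is infinite. *)
Definition nil_exponent (R : rngType) : nat :=
  least (fun k => forall x : R, nilpotent_elt x -> (x *+ k)%R = 0%R).

Definition nil_order_lcm (R : rngType) : nat :=
  least (fun M => forall x : R, nilpotent_elt x -> add_order x %| M).

(* mu_1(R), 0 standing for an infinite value *)
Definition exp_period (R : rngType) : nat :=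
  least (fun n =>
    forall x : R, exists2 m, 0 < m & rpow x (m + n) = rpow x m).

(* mu_0(R), 0 standing for an infinite value; only meaningful when
   [exp_period R] is nonzero. *)
Definition exp_onset (R : rngType) : nat :=
  greatest_value (fun x : R =>
    least (fun m => rpow x (m + exp_period R) = rpow x m)).

Definition periodic_power_maps (R : rngType) : set (R -> R) :=
  [set f | periodic f /\ exists2 n, 0 < n & f = power_map R n].
Arguments periodic_power_maps : clear implicits.

(* mu_P(R); [fset_set] is only meaningful for finite sets. *)
Definition nb_periodic_power_maps (R : rngType) : nat :=
  #|` fset_set (periodic_power_maps R)|%fset.

Definition omega (d : nat) : nat := size (primes d).

Definition radical (d : nat) : nat := \prod_(p <- primes d) p.

Definition mobius (d : nat) : int :=
  (if has (fun p => (p ^ 2 %| d)%N) (primes d) then 0 else (-1) ^+ omega d)%R.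

(* Main.v *)
Require Import Defs.
From mathcomp Require Import all_boot all_order all_algebra finmap.
From mathcomp Require Import all_classical.
From mathcomp Require Import ring zify.

Set Implicit Arguments.
Unset Strict Implicit.
Unset Printing Implicit Defensive.

Import Order.TTheory GRing.Theory Num.Theory.
Local Open Scope classical_set_scope.
Local Open Scope ring_scope.

(** Everything rests on two observations about a nilpotent [h].

    If [h * h = 0] and [p] kills [h], then for [n] divisible by [p] the binomial
    expansion of [(x + h) ^ n] stops at [x ^ n + n x ^ (n - 1) h = x ^ n], so [h]
    is a period of the [n]-th power map. For every prime [p] dividing [N] such an
    [h <> 0] exists ([square_zero_torsion]), because minimality of [N] gives a
    nilpotent [x] with [x *+ (N %/ p) <> 0], and the last nonzero power of that
    element squares to zero. This gives periodicity for all [n] not coprime to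
    [N] ([periodic_of_not_coprime]).

    Conversely, let [e] be the identity of [R] and [h] a period of the [n]-th power
    map. Evaluating at [0] shows [h ^ n = 0], and evaluating at [e] gives
    [(e + h) ^ n = e], that is [n h] lies in [h ^ 2 R]. Were [n] invertible
    modulo [N], which kills [h], then [h] itself would lie in [h ^ 2 R], hence
    in every [h ^ k R], hence be [0] ([not_coprime_of_periodic]).

    What remains is counting. With [M = mu_0 + mu_1 - 1], the power maps of
    exponents [1, ..., M] are pairwise distinct and exhaust all power maps
    ([power_map_inj], [power_map_iota]), so the periodic ones are counted by the
    periodic exponents up to [M]; these include all those not coprime to [N],
    and nothing else when [R] is finite and unital. Finally, both divisor sums
    count the [n <= M] not coprime to [N]: only squarefree divisors of [N], i.e.
    divisors of its radical, contribute to the Moebius sum, and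
    [sum_sign_omega] is inclusion-exclusion over the primes of [N]. *)

(** * Least and greatest values *)

Lemma leastP (P : nat -> Prop) : (0 < least P)%N ->
  P (least P) /\ (forall m, (0 < m)%N -> P m -> (least P <= m)%N).
Proof. by rewrite /least; case: xgetP => [n _ [_ Pn min_n] | //]. Qed.

Lemma least_gt0 (P : nat -> Prop) n : (0 < n)%N -> P n -> (0 < least P)%N.
Proof.
move=> n_gt0 Pn.
have exP : exists k, `[< (0 < k)%N /\ P k >] by exists n; apply/asboolP.
have [k /asboolP[k_gt0 Pk] min_k] := ex_minnP exP.
rewrite /least; case: xgetP => [m _ [] // | noP]; case: (noP k).
by split=> // m m_gt0 Pm; apply/min_k/asboolP.
Qed.

Lemma greatest_valueP (T : Type) (F : T -> nat) :
  (0 < greatest_value F)%N ->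
  (exists x, F x = greatest_value F) /\ (forall x, (F x <= greatest_value F)%N).
Proof. by rewrite /greatest_value; case: xgetP => [m _ []|]. Qed.

Lemma greatest_value_gt0 (T : Type) (F : T -> nat) (x0 : T) b :
  (forall x, (0 < F x <= b)%N) -> (0 < greatest_value F)%N.
Proof.
move=> Fb.
have exF : exists k, `[< exists x, F x = k >].
  by exists (F x0); apply/asboolP; exists x0.
have ubF k : `[< exists x, F x = k >] -> (k <= b)%N.
  by move=> /asboolP[x <-]; case/andP: (Fb x).
have [k /asboolP[x Fx] max_k] := ex_maxnP exF ubF.
rewrite /greatest_value; case: xgetP => [m _ [[y <-] _] | noF].
  by case/andP: (Fb y).
case: (noF k); split; first by exists x.
by move=> y; apply/max_k/asboolP; exists y.
Qed.

(** * Counting by divisors of the radical *)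

(** This is the step that adds one prime [p] to a squarefree number: the
    divisors of [p * m] are those of [m], on which [omega] is unchanged, and
    their multiples by [p], on which [omega] grows by one and the sign flips. *)
Lemma perm_divisorsM p m : prime p -> ~~ (p %| m)%N -> (0 < m)%N ->
  perm_eq (divisors (p * m)) (divisors m ++ [seq (p * d)%N | d <- divisors m]).
Proof.
move=> p_pr p'm m_gt0; have p_gt0 := prime_gt0 p_pr.
apply: uniq_perm; first exact: divisors_uniq.
  rewrite cat_uniq divisors_uniq map_inj_uniq ?divisors_uniq ?andbT /=.
    apply/hasPn => _ /mapP[d _ ->]; rewrite -dvdn_divisors //.
    by apply: contra p'm; apply: dvdn_trans; rewrite dvdn_mulr.
  by move=> a b /eqP; rewrite eqn_pmul2l // => /eqP.
move=> d; rewrite mem_cat -!dvdn_divisors ?muln_gt0 ?p_gt0 //.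
apply/idP/orP => [dpm | [dm | /mapP[c]]].
- have [pd | p'd] := boolP (p %| d)%N; last first.
    by left; rewrite -(Gauss_dvdr m (_ : coprime d p)) // coprime_sym prime_coprime.
  right; apply/mapP; exists (d %/ p)%N; last by rewrite mulnC divnK.
  by rewrite -dvdn_divisors // -(dvdn_pmul2l p_gt0) mulnC divnK.
- exact: dvdn_mull.
- by rewrite -dvdn_divisors // => cm ->; rewrite dvdn_pmul2l.
Qed.

Lemma omegaM_prime p d : prime p -> ~~ (p %| d)%N -> (0 < d)%N ->
  omega (p * d) = (omega d).+1.
Proof.
move=> p_pr p'd d_gt0; rewrite /omega -[RHS]/(size (p :: primes d)).
apply: perm_size; apply: uniq_perm; rewrite ?primes_uniq //=.
  by rewrite primes_uniq mem_primes p_pr d_gt0 (negPf p'd).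
by move=> q; rewrite inE primesM ?(prime_gt0 p_pr) // primes_prime // inE.
Qed.

Lemma dvdn_prod_primes p (ps : seq nat) : prime p -> all prime ps ->
  (p %| \prod_(q <- ps) q)%N = (p \in ps).
Proof.
move=> p_pr; elim: ps => [|q ps IH] /=; first by rewrite big_nil Euclid_dvd1.
by case/andP=> q_pr ps_pr; rewrite big_cons Euclid_dvdM // IH // dvdn_prime2.
Qed.

Lemma prod_primes_gt0 (ps : seq nat) : all prime ps ->
  (0 < \prod_(q <- ps) q)%N.
Proof.
by move/allP=> ps_pr; rewrite big_seq prodn_cond_gt0 // => q /ps_pr/prime_gt0.
Qed.

(** Inclusion-exclusion, one prime at a time. Adding [p] multiplies the sum by
    one minus the indicator of [p %| n]: for [d] prime to [p], [p * d] divides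
    [n] exactly when both [p] and [d] do. *)
Lemma sum_sign_omega (ps : seq nat) n : all prime ps -> uniq ps ->
  \sum_(d <- divisors (\prod_(p <- ps) p)%N) (-1) ^+ omega d * (d %| n)%N%:Z
  = (all (fun p => ~~ (p %| n)%N) ps)%:Z.
Proof.
elim: ps => [|p ps IH] /=.
  by move=> _ _; rewrite big_nil big_seq1 dvd1n.
move=> /andP[p_pr ps_pr] /andP[p'ps ps_uniq].
have r_gt0 := prod_primes_gt0 ps_pr.
have p'r : ~~ (p %| \prod_(q <- ps) q)%N by rewrite dvdn_prod_primes.
rewrite big_cons (perm_big _ (perm_divisorsM p_pr p'r r_gt0)) big_cat big_map /=.
have -> : \sum_(d <- divisors (\prod_(q <- ps) q)%N)
      (-1) ^+ omega (p * d) * (p * d %| n)%N%:Z =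
    - (p %| n)%N%:Z * \sum_(d <- divisors (\prod_(q <- ps) q)%N)
      (-1) ^+ omega d * (d %| n)%N%:Z :> int.
  rewrite mulr_sumr big_seq [RHS]big_seq; apply: eq_bigr => d.
  rewrite -dvdn_divisors // => dr.
  have p'd : ~~ (p %| d)%N by apply: contra p'r => /dvdn_trans->.
  rewrite omegaM_prime ?(dvdn_gt0 _ dr) // Gauss_dvd ?prime_coprime //.
  by rewrite -mulnb PoszM exprS; ring.
by rewrite (IH ps_pr ps_uniq); case: (p %| n)%N; case: all.
Qed.

Lemma coprime_all_primes n N : (0 < n)%N -> (0 < N)%N ->
  coprime n N = all (fun p => ~~ (p %| n)%N) (primes N).
Proof.
move=> n_gt0 N_gt0; rewrite coprime_has_primes // -all_predC.
apply: eq_in_all => p; rewrite mem_primes => /and3P[p_pr _ _] /=.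
by rewrite mem_primes p_pr n_gt0.
Qed.

(** Legendre's sieve: [M %/ d] counts the multiples of [d] up to [M], so after
    exchanging the sums [sum_sign_omega] evaluates the inner one to the
    indicator of coprimality with [N]. *)
Lemma legendre_count N M : (0 < N)%N ->
  \sum_(d <- divisors (radical N)) (-1) ^+ omega d * (M %/ d)%N%:Z
  = (count (coprime^~ N) (iota 1 M))%:Z.
Proof.
move=> N_gt0.
have primesP : all prime (primes N).
  by apply/allP => p; rewrite mem_primes => /andP[].
transitivity (\sum_(1 <= n < M.+1) \sum_(d <- divisors (radical N))
    (-1) ^+ omega d * (d %| n)%N%:Z : int).
  rewrite exchange_big; apply: eq_bigr => d _.
  by rewrite -mulr_sumr divn_count_dvd -!natz natr_sum; congr (_ * _);
     apply: eq_bigr => i _; rewrite natz.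
rewrite -sum1_count -natz natr_sum [RHS]big_mkcond /index_iota subn1 /=.
rewrite big_seq [RHS]big_seq.
apply: eq_bigr => n; rewrite mem_iota => /andP[n_gt0 _].
rewrite sum_sign_omega ?primes_uniq // -coprime_all_primes //.
by case: coprime.
Qed.

Lemma logn_radical p N : prime p -> logn p (radical N) = (p \in primes N).
Proof.
move=> p_pr; rewrite /radical -(count_uniq_mem _ (primes_uniq N)).
have : all prime (primes N) by apply/allP => q; rewrite mem_primes => /andP[].
elim: (primes N) => [|q ps IH] /=; first by rewrite big_nil logn1.
case/andP=> q_pr ps_pr; rewrite big_cons lognM ?prod_primes_gt0 ?prime_gt0 //.
by rewrite IH // logn_prime // eq_sym.
Qed.

Lemma radical_gt0 N : (0 < radical N)%N.
Proof.
by apply: prod_primes_gt0; apply/allP => q; rewrite mem_primes => /andP[].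
Qed.

(** All valuations of [radical N] are at most one, so a divisor of it is
    squarefree; conversely a squarefree divisor of [N] is compared with
    [radical N] prime by prime. *)
Lemma dvdn_radical N d : (0 < N)%N ->
  (d %| radical N)%N =
  (d %| N)%N && ~~ has (fun p => (p ^ 2 %| d)%N) (primes d).
Proof.
move=> N_gt0; have rN_gt0 := radical_gt0 N.
apply/idP/andP => [dr | [dN /hasPn sqf_d]].
  have d_gt0 := dvdn_gt0 rN_gt0 dr.
  have le_d p : prime p -> (logn p d <= (p \in primes N))%N.
    by move=> p_pr; rewrite -logn_radical // dvdn_leq_log.
  split.
    apply/dvdn_partP => // p; rewrite mem_primes => /and3P[p_pr _ pd].
    rewrite p_part pfactor_dvdn //; apply: leq_trans (le_d p p_pr) _.
    by rewrite -logn_gt0; case: (logn p N).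
  apply/hasPn => p; rewrite mem_primes => /and3P[p_pr _ _].
  by rewrite pfactor_dvdn // -ltnNge (leq_ltn_trans (le_d p p_pr)) //; case: (p \in _).
have d_gt0 := dvdn_gt0 N_gt0 dN.
apply/dvdn_partP => // p p_d; have := p_d.
rewrite mem_primes => /and3P[p_pr _ pd].
rewrite p_part pfactor_dvdn // logn_radical // mem_primes p_pr N_gt0.
rewrite (dvdn_trans pd dN) /=.
by have := sqf_d p p_d; rewrite pfactor_dvdn // -ltnNge.
Qed.

(** The Moebius function vanishes off the squarefree divisors, which by
    [dvdn_radical] are the divisors of the radical. *)
Lemma mobius_sum_radical N (F : nat -> int) : (0 < N)%N ->
  \sum_(d <- divisors N | d != 1%N) mobius d * F d =
  \sum_(d <- divisors (radical N) | d != 1%N) (-1) ^+ omega d * F d.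
Proof.
move=> N_gt0; pose sqf d := ~~ has (fun p => (p ^ 2 %| d)%N) (primes d).
have perm_rad : perm_eq (divisors (radical N)) [seq d <- divisors N | sqf d].
  apply: uniq_perm; rewrite ?filter_uniq ?divisors_uniq // => d.
  by rewrite mem_filter -!dvdn_divisors ?radical_gt0 // dvdn_radical // andbC.
rewrite (perm_big _ perm_rad) big_filter_cond big_mkcond [RHS]big_mkcond /=.
apply: eq_bigr => d _; rewrite /mobius /sqf.
set b := has _ _; case: b; case: (d != 1%N) => //=.
by rewrite mul0r.
Qed.

Lemma radical_sum_sign N (F : nat -> int) :
  \sum_(d <- divisors (radical N) | d != 1%N) (-1) ^+ (omega d).+1 * F d =
  - \sum_(d <- divisors (radical N) | d != 1%N) (-1) ^+ omega d * F d.
Proof.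
by rewrite -sumrN; apply: eq_bigr => d _; rewrite exprS mulN1r mulNr.
Qed.

Lemma radical_sum_count N M : (0 < N)%N ->
  \sum_(d <- divisors (radical N) | d != 1%N) (-1) ^+ (omega d).+1 * (M %/ d)%N%:Z
  = (count (fun n => ~~ coprime n N) (iota 1 M))%:Z.
Proof.
move=> N_gt0; rewrite radical_sum_sign.
have in1 : 1%N \in divisors (radical N) by rewrite -dvdn_divisors ?radical_gt0.
have := legendre_count M N_gt0.
rewrite (bigD1_seq 1%N) ?divisors_uniq //= divn1 mul1r => sumM.
have := count_predC (coprime^~ N) (iota 1 M); rewrite size_iota.
move: sumM; set s := \sum_(_ <- _ | _) _.
rewrite [count (predC _) _](_ : _ = count (fun n => ~~ coprime n N) (iota 1 M)) //.
by move: (count _ _) => a; lia.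
Qed.

(** * Powers and additive orders in a rng *)

Section RngArithmetic.
Variable R : rngType.
Implicit Types (x y h : R) (i j k n : nat).

Lemma rng0g x : (0 * x)%g = 0 :> R.
Proof. by apply: (addrI (0 * x)%g); rewrite -rngDl !addr0. Qed.

Lemma rngg0 x : (x * 0)%g = 0 :> R.
Proof. by apply: (addrI (x * 0)%g); rewrite -rngDr !addr0. Qed.

Lemma rngMnr x y n : (x * (y *+ n))%g = (x * y)%g *+ n :> R.
Proof. by elim: n => [|n IH]; rewrite ?rngg0 // !mulrS rngDr IH. Qed.

Lemma rngMnl x y n : ((x *+ n) * y)%g = (x * y)%g *+ n :> R.
Proof. by elim: n => [|n IH]; rewrite ?rng0g // !mulrS rngDl IH. Qed.

Lemma rpowS x n : (0 < n)%N -> rpow x n.+1 = (x * rpow x n)%g.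
Proof. by case: n. Qed.

Lemma rpowD x m n : (0 < m)%N -> (0 < n)%N ->
  rpow x (m + n) = (rpow x m * rpow x n)%g.
Proof.
elim: m => // m IH _ n_gt0; case: (posnP m) => [-> | m_gt0]; first exact: rpowS.
by rewrite addSn !rpowS ?addn_gt0 ?m_gt0 // IH // mulgA.
Qed.

Lemma rpow_shift x i j k : (0 < i)%N -> (0 < j)%N ->
  rpow x i = rpow x j -> rpow x (i + k) = rpow x (j + k).
Proof.
by case: (posnP k) => [-> | k_gt0 i_gt0 j_gt0 eq_ij];
   rewrite ?addn0 // !rpowD // eq_ij.
Qed.

Lemma rpow0 n : rpow (0 : R) n = 0.
Proof. by rewrite /rpow; case: n.-1 => [|m] //=; rewrite rng0g. Qed.

Lemma rpow_loop x i d t : (0 < i)%N ->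
  rpow x (i + d) = rpow x i -> rpow x (i + t * d) = rpow x i.
Proof.
move=> i_gt0 loop; elim: t => [|t IH]; first by rewrite addn0.
rewrite mulSn addnA -[RHS]IH; apply: rpow_shift => //.
by rewrite addn_gt0 i_gt0.
Qed.

(** A loop of any length at exponent [i] lets [i] be replaced by an arbitrarily
    large exponent, where the eventual period [p] is already in force. Hence [p]
    is a period from [i] on, although nothing relates [d] and [p]. *)
Lemma rpow_loop_period x i d m p : (0 < i)%N -> (0 < d)%N -> (0 < m)%N ->
  rpow x (i + d) = rpow x i -> rpow x (m + p) = rpow x m ->
  rpow x (i + p) = rpow x i.
Proof.
move=> i_gt0 d_gt0 m_gt0 loop_i period_m.
have loop_p : rpow x (m + (i + m * d - m) + p) = rpow x (m + (i + m * d - m)).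
  by rewrite addnAC; apply: rpow_shift; rewrite ?addn_gt0 ?m_gt0.
have le_m : (m <= i + m * d)%N by rewrite (leq_trans (leq_pmulr m d_gt0)) ?leq_addl.
move: loop_p; rewrite subnKC // => loop_p.
(* [m] turns of the loop lead past the exponent [m]. *)
rewrite -[RHS](rpow_loop m i_gt0 loop_i) // -loop_p.
by apply: rpow_shift; rewrite ?rpow_loop // addn_gt0 i_gt0.
Qed.

Lemma rpow_mulrn0 x n k : x *+ k = 0 -> rpow x n *+ k = 0.
Proof. by rewrite /rpow => xk0; case: n.-1 => [|m] //=; rewrite -rngMnl xk0 rng0g. Qed.

Lemma add_orderP x k : (0 < k)%N -> x *+ k = 0 ->
  (0 < add_order x)%N /\ (forall n, x *+ n = 0 <-> (add_order x %| n)%N).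
Proof.
move=> k_gt0 xk0; have ord_gt0 : (0 < add_order x)%N by apply: least_gt0 xk0.
split=> // n; have [xord0 min_ord] := leastP ord_gt0.
rewrite -/(add_order x) in xord0 min_ord.
split=> [xn0 | /dvdnP[q ->]]; last by rewrite mulnC mulrnA xord0 mul0rn.
rewrite /dvdn; case: posnP => // r_gt0.
suff xr0 : x *+ (n %% add_order x) = 0.
  by have := min_ord _ r_gt0 xr0; rewrite leqNgt ltn_mod ord_gt0.
move: xn0; rewrite {1}(divn_eq n (add_order x)) mulrnDr mulnC mulrnA.
by rewrite xord0 mul0rn add0r.
Qed.

End RngArithmetic.

(** * Nilpotent elements *)

Section Nilpotents.
Variable R : rngType.
Hypothesis nil_exponent_finite : (0 < nil_exponent R)%N.
Let N := nil_order_lcm R.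

Lemma nil_add_orderP (x : R) : nilpotent_elt x ->
  (0 < add_order x)%N /\ (forall n, x *+ n = 0 <-> (add_order x %| n)%N).
Proof.
have [kill _] := leastP nil_exponent_finite.
by move/kill; apply: add_orderP.
Qed.

(** Having additive order dividing [m] means being killed by [m], so [N] is
    also the exponent of the nilpotents; the proofs below use it in that form. *)
Lemma nil_order_lcmP : [/\ (0 < N)%N,
  forall x : R, nilpotent_elt x -> x *+ N = 0 &
  forall m, (0 < m)%N ->
    (forall x : R, nilpotent_elt x -> x *+ m = 0) -> (N <= m)%N].
Proof.
have [kill _] := leastP nil_exponent_finite.
have N_gt0 : (0 < N)%N.
  apply: least_gt0 nil_exponent_finite _ => x nil_x.
  by have [_ ordP] := nil_add_orderP nil_x; apply/ordP/kill.
have [ordN minN] := leastP N_gt0.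
split=> // [x nil_x | m m_gt0 kill_m].
  by have [_ ordP] := nil_add_orderP nil_x; apply/ordP/ordN.
apply: minN => // x nil_x.
by have [_ ordP] := nil_add_orderP nil_x; apply/ordP/kill_m.
Qed.

(** Minimality of [N] leaves a nilpotent [x] that [N %/ p] does not kill; the
    multiple [y] of [x] is then a nonzero nilpotent killed by [p]. If [l.+2] is
    the least exponent with [y ^ l.+2 = 0], then [h = y ^ l.+1] works, since
    [2 (l + 1) >= l + 2]. *)
Lemma square_zero_torsion p : prime p -> (p %| N)%N ->
  exists h : R, [/\ h <> 0, (h * h)%g = 0 & h *+ p = 0].
Proof.
move=> p_pr pN; have [N_gt0 killN minN] := nil_order_lcmP.
have Np_gt0 : (0 < N %/ p)%N by rewrite divn_gt0 ?prime_gt0 // dvdn_leq.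
have [x [[n n_gt0 xn0] yN0]] :
    exists x : R, nilpotent_elt x /\ x *+ (N %/ p) <> 0.
  apply: contrapT => none.
  suff : (N <= N %/ p)%N by rewrite leqNgt ltn_Pdiv ?prime_gt1.
  by apply: minN => // x nil_x; apply: contrapT => xN; apply: none; exists x.
pose y := x *+ (N %/ p).
have yp0 : y *+ p = 0 by rewrite -mulrnA divnK // killN //; exists n.
have powy k : (0 < k)%N -> exists c, rpow y k = rpow x k *+ c.
  elim: k => // k IH _; case: (posnP k) => [-> | k_gt0]; first by exists (N %/ p)%N.
  have [c yk] := IH k_gt0; exists (c * (N %/ p))%N.
  by rewrite !rpowS // yk rngMnl rngMnr mulrnA.
have [k k_gt0 yk0] : exists2 k, (0 < k)%N & rpow y k = 0.
  by exists n => //; have [c ->] := powy n n_gt0; rewrite xn0 mul0rn.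
have l_gt0 := @least_gt0 (fun k => rpow y k = 0) k k_gt0 yk0.
have [] := leastP l_gt0; move: l_gt0.
case: (least _) => // -[|l] _ yl0 min_l; first by case: yN0; exact: yl0.
exists (rpow y l.+1); split; last exact: rpow_mulrn0.
  by move=> /(min_l l.+1 isT); rewrite ltnn.
rewrite -rpowD // addSnnS addnC.
case: (posnP l) => [l0 | l_gt0]; first by rewrite [X in (_ + X)%N]l0 addn0.
by rewrite rpowD // yl0 rng0g.
Qed.

End Nilpotents.

(** * Periods of power maps *)

Section PowerMapPeriods.
Variable R : rngType.
Hypothesis mulC : forall x y : R, (x * y = y * x)%g.

(** The first-order binomial formula. The exponent is at least [2] so that
    [x ^ (n - 1)] makes sense without a unit. *)
Lemma rpow_addr_square_zero (x h : R) n : (h * h)%g = 0 ->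
  rpow (x + h) n.+2 = rpow x n.+2 + (rpow x n.+1 * h)%g *+ n.+2.
Proof.
move=> hh0; elim: n => [|n IH].
  rewrite /rpow /= rngDl !rngDr hh0 addr0 (mulC h x) -addrA.
  by rewrite mulr2n.
rewrite rpowS // IH rngDl (rngDr x) (rngDr h).
rewrite !rngMnr (mulC h (rpow x n.+1 * h)%g) -(mulgA (rpow x n.+1)) hh0.
rewrite rngg0 mul0rn addr0 (mulC h (rpow x n.+2)) (mulgA x (rpow x n.+1) h).
rewrite -(@rpowS R x n.+1) //.
by rewrite -addrA -mulrSr.
Qed.

Lemma rpow_unit_addr (e h : R) n : (forall x : R, (e * x)%g = x) ->
  exists c, rpow (e + h) n.+1 = e + h *+ n.+1 + (h * (h * c))%g.
Proof.
move=> mul1; elim: n => [|n [c IH]].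
  by exists 0; rewrite /rpow /= !rngg0 addr0.
exists (c + (e *+ n.+1 + (h * c)%g)).
rewrite rpowS // IH rngDl mul1 (rngDr h (e + _)) (rngDr h e) rngMnr.
rewrite (rngDr h c) (rngDr h (e *+ _)) rngMnr (mulC h e) mul1.
rewrite (rngDr h (h * c)%g) (rngDr h (h *+ _)) rngMnr.
rewrite [h *+ n.+2]mulrS !addrA; do 2 congr (_ + _).
by rewrite [LHS]addrAC [e + h + _]addrAC.
Qed.

Hypothesis nil_exponent_finite : (0 < nil_exponent R)%N.
Let N := nil_order_lcm R.

(** A common prime [p] of [n] and [N] kills the only perturbation term
    [n x ^ (n - 1) h] that a square-zero [h] can produce. *)
Lemma periodic_of_not_coprime n : (0 < n)%N -> ~~ coprime n N ->
  periodic (power_map R n).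
Proof.
move=> n_gt0; have [N_gt0 _ _] := nil_order_lcmP nil_exponent_finite.
rewrite coprime_all_primes // -has_predC.
move=> /hasP[p]; rewrite mem_primes => /and3P[p_pr _ pN] /negPn pn.
have [h [h_neq0 hh0 hp0]] := square_zero_torsion nil_exponent_finite p_pr pN.
exists h => // x; rewrite /power_map.
have : (1 < n)%N by rewrite (leq_trans (prime_gt1 p_pr)) // dvdn_leq.
case: n pn {n_gt0} => [|[|n]] // pn _; rewrite rpow_addr_square_zero //.
by have /dvdnP[q ->] := pn; rewrite -rngMnr mulnC mulrnA hp0 mul0rn rngg0 addr0.
Qed.

(** If [n] were invertible modulo [N], the relation [n h = - h ^ 2 c] coming from
    [(e + h) ^ n = e] would put [h] in [h ^ 2 R], which forces the nilpotent [h]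
    to vanish. *)
Lemma not_coprime_of_periodic n : unital R -> (0 < n)%N ->
  periodic (power_map R n) -> ~~ coprime n N.
Proof.
move=> [e unit_e] n_gt0 [h h_neq0 per_h].
have [N_gt0 killN _] := nil_order_lcmP nil_exponent_finite.
have mul1 x : (e * x)%g = x by case: (unit_e x).
have hn0 : rpow h n = 0 by have := per_h 0; rewrite /power_map add0r rpow0.
have hN0 : h *+ N = 0 by apply: killN; exists n.
have pow_e k : rpow e k = e.
  by rewrite /rpow; elim: k.-1 => [|m] //= ->; rewrite mul1.
apply/negP => co_nN; case: h_neq0.
have [c eq_c] : exists c, h = (h * (h * c))%g.
  have [c] := rpow_unit_addr h n.-1 mul1; rewrite prednK //.
  have := per_h e; rewrite /power_map pow_e => ->.
  rewrite -addrA -{1}[e]addr0 => /addrI/esym/eqP.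
  rewrite addr_eq0 => /eqP hn.
  (* [a] is an inverse of [n] modulo [N], and [N] kills [h]. *)
  have [a b ab _] := egcdnP N n_gt0.
  have h_an : h = h *+ n *+ a.
    by rewrite -mulrnA mulnC ab (eqP co_nN) mulrnDr mulnC mulrnA hN0 mul0rn add0r.
  exists (- c *+ a); rewrite {1}h_an hn !rngMnr; congr (_ *+ _).
  by apply/eqP; rewrite eq_sym -addr_eq0 -!rngDr addNr !rngg0.
have absorb k : (0 < k)%N -> exists c', h = (rpow h k * c')%g.
  case: k => // k _; elim: k => [|k [c' IH]].
    by exists (h * c)%g.
  exists (c' * c)%g; rewrite {1}eq_c.
  transitivity (h * ((rpow h k.+1 * c') * c))%g; first by rewrite -IH.
  by rewrite (@rpowS R h k.+1) // !mulgA.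
by have [c' ->] := absorb n n_gt0; rewrite hn0 rng0g.
Qed.

End PowerMapPeriods.

(** * Enumerating the power maps *)

Section PowerMapCount.
Variable R : rngType.
Hypothesis period_gt0 : (0 < exp_period R)%N.
Hypothesis onset_gt0 : (0 < exp_onset R)%N.
Let mu1 := exp_period R.
Let mu0 := exp_onset R.
Let M := (mu0 + mu1 - 1)%N.

Lemma rpow_onset (x : R) i : (mu0 <= i)%N -> rpow x (i + mu1) = rpow x i.
Proof.
move=> le_i; have [per _] := leastP period_gt0; rewrite -/(exp_period R) -/mu1 in per.
have [m m_gt0 loop_m] := per x.
have least_gt0 := @least_gt0 (fun m => rpow x (m + mu1) = rpow x m) m m_gt0 loop_m.
have [loop _] := leastP least_gt0.
have [_ /(_ x) le_mu0] := greatest_valueP onset_gt0.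
rewrite -(subnKC (leq_trans le_mu0 le_i)) addnAC.
by apply: rpow_shift => //; rewrite addn_gt0 least_gt0.
Qed.

Lemma onset_le i : (0 < i)%N ->
  (forall x : R, rpow x (i + mu1) = rpow x i) -> (mu0 <= i)%N.
Proof.
move=> i_gt0 loop_i; have [[x mu0x] _] := greatest_valueP onset_gt0.
rewrite /mu0 /exp_onset -mu0x.
have [] := leastP (@least_gt0 (fun m => rpow x (m + mu1) = rpow x m) i i_gt0 (loop_i x)).
by move=> _; apply.
Qed.

(** Suppose the maps of exponents [i < j <= M] agree. Then [j - i] is an
    exponential period of every element, so [mu_1 <= j - i] by minimality; and
    [rpow_loop_period] makes [mu_1] a period from [i] on, so [mu_0 <= i].
    Together [j >= mu_0 + mu_1 > M]. *)
Lemma power_map_inj : {in iota 1 M &, injective (power_map R)}.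
Proof.
have [per min_per] := leastP period_gt0.
rewrite -/(exp_period R) -/mu1 in per min_per.
have lt_absurd i j : (0 < i)%N -> (i < j <= M)%N -> power_map R i <> power_map R j.
  move=> i_gt0 /andP[lt_ij le_jM] eq_ij.
  have d_gt0 : (0 < j - i)%N by rewrite subn_gt0.
  have loop (x : R) : rpow x (i + (j - i)) = rpow x i.
    by rewrite subnKC ?(ltnW lt_ij) //;
       exact: (esym (congr1 (fun f : R -> R => f x) eq_ij)).
  have le_mu1 : (mu1 <= j - i)%N by apply: min_per => // x; exists i.
  have le_mu0 : (mu0 <= i)%N.
    apply: onset_le => // x; have [m m_gt0 loop_m] := per x.
    exact: rpow_loop_period (loop x) loop_m.
  by move: le_jM le_mu0 le_mu1 lt_ij period_gt0; rewrite /M -/mu1; lia.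
move=> i j; rewrite !mem_iota !add1n !ltnS => /andP[i_gt0 iM] /andP[j_gt0 jM] eq_ij.
case: (ltngtP i j) => // lt_ij.
  by case: (lt_absurd i j); rewrite ?lt_ij.
by case: (lt_absurd j i); rewrite ?lt_ij.
Qed.

(** An exponent above [M] is at least [mu_0 + mu_1], so subtracting [mu_1] from
    it does not change the power map. *)
Lemma power_map_iota n : (0 < n)%N ->
  exists2 i, i \in iota 1 M & power_map R n = power_map R i.
Proof.
elim/ltn_ind: n => n IH n_gt0; have [le_nM | lt_Mn] := leqP n M.
  by exists n => //; rewrite mem_iota n_gt0 add1n ltnS.
have le_n : (mu0 + mu1 <= n)%N by move: lt_Mn; rewrite /M; lia.
have [||i iM eq_i] := IH (n - mu1)%N.
- by move: period_gt0 n_gt0; rewrite -/mu1; lia.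
- by move: onset_gt0 le_n; rewrite -/mu0; lia.
exists i => //; rewrite -eq_i; apply/funext => x; rewrite /power_map.
have le_mu1 : (mu1 <= n)%N by apply: leq_trans le_n; apply: leq_addl.
rewrite -{1}(subnK le_mu1) rpow_onset //.
by rewrite leq_subRL // addnC.
Qed.

Lemma periodic_power_maps_seq : periodic_power_maps R =
  [set` [seq power_map R n | n <- iota 1 M & `[< periodic (power_map R n) >]]].
Proof.
apply/seteqP; split=> f /=.
  move=> [per_f [n n_gt0 eq_f]]; have [i iM eq_ni] := power_map_iota n_gt0.
  apply/mapP; exists i; last by rewrite eq_f.
  by rewrite mem_filter iM andbT; apply/asboolP; rewrite -eq_ni -eq_f.
move=> /mapP[n]; rewrite mem_filter mem_iota => /and3P[/asboolP per_n n_gt0 _] ->.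
by split=> //; exists n.
Qed.

Lemma finite_periodic_power_maps : finite_set (periodic_power_maps R).
Proof. by rewrite periodic_power_maps_seq; apply: finite_seq. Qed.

Lemma nb_periodic_power_maps_count : nb_periodic_power_maps R =
  count (fun n => `[< periodic (power_map R n) >]) (iota 1 M).
Proof.
rewrite /nb_periodic_power_maps periodic_power_maps_seq.
set s := map _ _.
have -> : [set` s] = [set` [fset f in s]%fset].
  by apply/seteqP; split=> f /=; rewrite inE.
rewrite set_fsetK card_fseq undup_id ?size_map ?size_filter //.
rewrite map_inj_in_uniq ?filter_uniq ?iota_uniq // => i j.
rewrite !mem_filter => /andP[_ iM] /andP[_ jM]; exact: power_map_inj.
Qed.

End PowerMapCount.

(** * Exponential periodicity of finite rings *)

(** By pigeonhole the powers of [x] repeat within the first [K] exponents as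
    soon as [K] exceeds the number of elements. The gap is then less than [K],
    hence divides [K`!], which makes one pair (onset, period) serve all elements
    at once. *)
Lemma finite_rpow_loop (R : rngType) : finite_set [set: R] ->
  exists2 K, (0 < K)%N & forall x : R, rpow x (K + K`!) = rpow x K.
Proof.
move=> /finite_seqP[s sT]; have in_s x : x \in s.
  by have : [set: R] x by []; rewrite sT.
exists (size s).+1 => // x; set K := (size s).+1.
have : ~~ uniq [seq rpow x i | i <- iota 1 K].
  apply/negP => /uniq_leq_size/(_ (fun y _ => in_s y)).
  by rewrite size_map size_iota ltnn.
move=> /(uniqPn 0)[i [j [lt_ij]]]; rewrite size_map size_iota => lt_jK.
rewrite !(nth_map 0%N) ?size_iota ?(ltn_trans lt_ij) // !nth_iota ?(ltn_trans lt_ij) //.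
rewrite !add1n => eq_ij.
have loop_i : rpow x (i.+1 + (j - i)) = rpow x i.+1 by rewrite addSn subnKC ?(ltnW lt_ij).
have iK : (i.+1 <= K)%N by rewrite (ltn_trans lt_ij).
have /dvdnP[q ->] : (j - i %| K`!)%N.
  apply: dvdn_fact; rewrite subn_gt0 lt_ij leq_subLR.
  by rewrite (leq_trans (ltnW lt_jK)) ?leq_addl.
rewrite -(subnKC iK) -addnA [(_ + q * _)%N]addnC addnA.
by apply: rpow_shift; rewrite ?addn_gt0 ?rpow_loop.
Qed.

Lemma finite_exp_period_onset (R : rngType) : finite_set [set: R] ->
  (0 < exp_period R)%N /\ (0 < exp_onset R)%N.
Proof.
move=> /finite_rpow_loop[K K_gt0 loopK].
have per_gt0 : (0 < exp_period R)%N.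
  by apply: (@least_gt0 _ K`!); [exact: fact_gt0 | move=> x; exists K].
split=> //; apply: (@greatest_value_gt0 _ _ (0 : R) K) => x.
have [per _] := leastP per_gt0; have [m m_gt0 loop_m] := per x.
have loop := rpow_loop_period K_gt0 (fact_gt0 K) m_gt0 (loopK x) loop_m.
have gt0 := @least_gt0 (fun m => rpow x (m + exp_period R) = rpow x m) K K_gt0 loop.
by rewrite gt0 /=; have [_] := leastP gt0; apply.
Qed.

(** * The number of periodic power maps *)

Unset Implicit Arguments.

Theorem theorem3p1 (R : rngType)
    (mulC : forall x y : R, (x * y = y * x)%g)
    (nil_exponent_finite : (0 < nil_exponent R)%N) :
  let N := nil_order_lcm R in
  let M := (exp_onset R + exp_period R - 1)%N in
  let muP : int := (nb_periodic_power_maps R)%:Z in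
  let mobius_sum : int :=
    - \sum_(d <- divisors N | d != 1%N) mobius d * (M %/ d)%N%:Z in
  let rad_sum : int :=
    \sum_(d <- divisors (radical N) | d != 1%N)
      (-1) ^+ (omega d).+1 * (M %/ d)%N%:Z in
  [/\ forall n : nat, (0 < n)%N -> ~~ coprime n N -> periodic (power_map R n),
      (0 < exp_period R)%N -> (0 < exp_onset R)%N ->
        [/\ finite_set (periodic_power_maps R),
            mobius_sum <= muP
          & mobius_sum = rad_sum]
    & finite_set [set: R] -> unital R ->
        muP = mobius_sum /\ muP = rad_sum].
Proof.
move=> N M muP mobius_sum rad_sum.
have [N_gt0 _ _] := nil_order_lcmP nil_exponent_finite.
have per_n := @periodic_of_not_coprime R mulC nil_exponent_finite.
have eq_sums : mobius_sum = rad_sum.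
  rewrite /mobius_sum /rad_sum radical_sum_sign.
  by rewrite (mobius_sum_radical (fun d => (M %/ d)%N%:Z) N_gt0).
have rad_count : rad_sum = (count (fun n => ~~ coprime n N) (iota 1 M))%:Z.
  exact: radical_sum_count.
split=> // [per_gt0 onset_gt0 | finR unitR].
  split=> //; first exact: finite_periodic_power_maps.
  rewrite eq_sums rad_count /muP nb_periodic_power_maps_count // lez_nat.
  (* [rpow x 0] is [x], a map without periods, so positivity of [n] has to
     accompany non-coprimality. *)
  rewrite (@eq_in_count _ _ (fun n => (0 < n)%N && ~~ coprime n N)).
    by apply: sub_count => n /andP[n_gt0 nN]; apply/asboolP/per_n.
  by move=> n; rewrite mem_iota => /andP[->].
have [per_gt0 onset_gt0] := finite_exp_period_onset finR.
suff -> : muP = rad_sum by [].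
rewrite rad_count /muP nb_periodic_power_maps_count //; congr Posz.
apply: eq_in_count => n; rewrite mem_iota => /andP[n_gt0 _].
apply/asboolP/idP; [exact: not_coprime_of_periodic | exact: per_n].
Qed.
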